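(* Let $\mathcal{A}$ be a unital associative complex algebra with identity $\mathbf{1}$. Then for any $a, b \in \mathcal{A}$ and any non-negative integer $n$, $$a^{n} = \sum_{k=0}^{n} \binom{n}{k}\, \delta_{a,b}^{\,n-k}(\mathbf{1})\, b^{k}.$$
   Context: For $b_1, b_2 \in \mathcal{A}$, the linear map $\delta_{b_1,b_2} : \mathcal{A} \to \mathcal{A}$ is defined by $\delta_{b_1,b_2}(x) = b_1 x - x b_2$ for $x \in \mathcal{A}$ (an inner generalized derivation). $\delta_{b_1,b_2}^{\,m}$ denotes the $m$-fold composition of $\delta_{b_1,b_2}$ with itself, with $\delta_{b_1,b_2}^{\,0}$ the identity map. For $x\in\mathcal{A}$, $x^0 = \mathbf{1}$. The algebra is not assumed commutative. *)

(* Defs.v *)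
From HB Require Import structures.
From mathcomp Require Import all_boot all_order all_algebra.
From mathcomp Require Import complex reals.

Set Implicit Arguments.
Unset Strict Implicit.
Unset Printing Implicit Defensive.

Import GRing.Theory.
Local Open Scope ring_scope.

(* [algType K] requires 1 != 0. [pzAlgType K] has the same axioms over a
   [pzRingType], so that the zero algebra is a unital algebra too. The scaling
   is a field of the mixin because HB refuses a structure joining [pzRingType]
   and [lmodType K] without the nontriviality axiom; the usual [*:] is recovered
   by the [lmodType K] instance below. *)
HB.mixin Record PzRing_isPzAlgebra (K : pzRingType) A of GRing.PzRing A := {
  pzscale : K -> A -> A;
  pzscalerA : forall k l x, pzscale k (pzscale l x) = pzscale (k * l) x;
  pzscale1r : left_id 1 pzscale;
  pzscalerDr : right_distributive pzscale +%R;
  pzscalerDl : forall x, {morph pzscale^~ x : k l / k + l};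
  pzscalerAl : forall k x y, pzscale k (x * y) = pzscale k x * y;
  pzscalerAr : forall k x y, pzscale k (x * y) = x * pzscale k y
}.

#[short(type="pzAlgType")]
HB.structure Definition PzAlgebra (K : pzRingType) :=
  {A of GRing.PzRing A & PzRing_isPzAlgebra K A}.

HB.instance Definition _ (K : pzRingType) (A : pzAlgType K) :=
  GRing.Zmodule_isLmodule.Build K (PzAlgebra.sort A)
    (@pzscalerA K A) (@pzscale1r K A) (@pzscalerDr K A) (@pzscalerDl K A).

HB.instance Definition _ (K : pzRingType) (A : algType K) :=
  PzRing_isPzAlgebra.Build K (GRing.Algebra.sort A)
    (@scalerA K A) (@scale1r K A) (@scalerDr K A)
    (fun x k l => @scalerDl K A x k l) (@scalerAl K A) (@scalerAr K A).

Section InnerGeneralizedDerivation.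
Variables (K : pzRingType) (A : pzAlgType K).

Definition inner_gder (b1 b2 x : A) : A := b1 * x - x * b2.

Lemma inner_gder_is_linear (b1 b2 : A) : linear (inner_gder b1 b2).
Proof.
move=> k x y; rewrite /inner_gder mulrDr mulrDl.
have -> : b1 * (k *: x) = k *: (b1 * x) by rewrite [RHS]pzscalerAr.
have -> : (k *: x) * b2 = k *: (x * b2) by rewrite [RHS]pzscalerAl.
by rewrite opprD addrACA scalerBr.
Qed.

HB.instance Definition _ (b1 b2 : A) :=
  GRing.isLinear.Build K A A *:%R (inner_gder b1 b2)
    (inner_gder_is_linear b1 b2).

End InnerGeneralizedDerivation.

(* Main.v *)
Require Import Defs.
From HB Require Import structures.
From mathcomp Require Import all_boot all_order all_algebra.
From mathcomp Require Import complex reals.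

Set Implicit Arguments.
Unset Strict Implicit.
Unset Printing Implicit Defensive.

Import GRing.Theory.
Local Open Scope ring_scope.

(** By associativity, [a * (y * b) - (y * b) * b = (a * y - y * b) * b], so [inner_gder a b]
    commutes with right multiplication by [b]. Induction on [n] with Pascal's rule then gives the
    expansion; the theorem is the case [x = 1]. *)

(* Left multiplication by [a] is [inner_gder a b] plus right multiplication by
   [b], and these two maps commute: this is the binomial theorem for their sum,
   applied to [x]. *)
Lemma exprM_inner_gder (K : pzRingType) (A : pzAlgType K) (a b x : A) n :
  a ^+ n * x =
    \sum_(k < n.+1) (iter (n - k) (inner_gder a b) x * b ^+ k) *+ 'C(n, k).
Proof.
elim: n => [|n IHn]; first by rewrite big_ord1 !expr0 mul1r mulr1.
have mulaE y k : a * (y * b ^+ k) = inner_gder a b y * b ^+ k + y * b ^+ k.+1.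
  by rewrite /inner_gder mulrBl exprS !mulrA subrK.
rewrite exprS -mulrA IHn mulr_sumr.
under eq_bigr => k _ do
  rewrite mulrnAr mulaE mulrnDl -iterS -subSn -1?ltnS ?ltn_ord//.
rewrite big_split /=.
(* Pascal's rule applies only to positive lower indices, so the terms at index 0 are matched
   separately. *)
rewrite [RHS]big_ord_recl [X in X + _ = _]big_ord_recl /= !bin0 -!addrA.
congr (_ + _).
under [RHS]eq_bigr => k _ do rewrite /bump add1n binS mulrnDr subSS.
rewrite big_split /=; congr (_ + _).
(* The extra top term on the right has coefficient ['C(n, n.+1) = 0]. *)
by rewrite [RHS]big_ord_recr /= bin_small// mulr0n addr0.
Qed.

Theorem theorem2p2 (R : realType) (A : pzAlgType R[i]) (a b : A) (n : nat) :
  a ^+ n =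
    \sum_(0 <= k < n.+1)
      'C(n, k)%:R *: (iter (n - k) (inner_gder a b) 1 * b ^+ k).
Proof.
rewrite -[LHS]mulr1 (exprM_inner_gder a b) big_mkord.
by apply: eq_bigr => k _; rewrite scaler_nat.
Qed.
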